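(* Let $a<b$ be real numbers and let $\ell,n,r\in\overline{\mathbb N}_0$ with $1\le\ell,r\le n$. Then the set $\mathscr{F}_{\ell,r}^{n}[a,b]$ is closed under (pointwise) function multiplication.
   Context: $\overline{\mathbb N}_0=\{0,1,2,\dots\}\cup\{\infty\}$. When an order equals $\infty$, the corresponding conditions are understood to hold for every finite derivative order. $C^n[a,b]$ denotes the real-valued $n$-times continuously differentiable functions on $[a,b]$ (one-sided derivatives at endpoints). For $1\le\ell,r\le n$, $\mathscr{F}_{\ell,r}^{n}[a,b]$ is the set of functions $h\in C^n[a,b]$ with flat ends of orders $\ell$ and $r$, i.e. with $h^{(j)}(a)=0$ for $j=1,\dots,\ell$ and $h^{(k)}(b)=0$ for $k=1,\dots,r$. *)

(* Defs.v *)
(* MathComp-Analysis *)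
From HB Require Import structures.
From mathcomp Require Import all_boot all_order all_algebra.
From mathcomp Require Import all_classical all_reals all_analysis.

Set Implicit Arguments.
Unset Strict Implicit.
Unset Printing Implicit Defensive.

Import Order.TTheory GRing.Theory Num.Theory.
Import numFieldNormedType.Exports.

Local Open Scope classical_set_scope.
Local Open Scope ring_scope.

Inductive enat : Type := Fin of nat | Infty.

Definition le_enat (m n : enat) : bool :=
  match m, n with
  | _, Infty => true
  | Infty, Fin _ => false
  | Fin p, Fin q => (p <= q)%N
  end.

(* A function on [a, b] is represented by a function R -> R of which only the
   values on [a, b] matter: difference quotients and limits at a point of
   [a, b] are taken along points of [a, b] only.  At a and b this yields the
   one-sided derivatives, at interior points the usual derivative. *)
Section Segment.
Context {R : realType}.
Variables a b : R.
Implicit Types (f : R -> R) (x : R).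

Definition segment_quotient f x : R -> R := fun y => (f y - f x) / (y - x).

Definition derivable_segment f x : Prop :=
  cvg (segment_quotient f x @ within `[a, b] x^').

(* The value is meaningful only when [derivable_segment f x]. *)
Definition derive_segment f : R -> R :=
  fun x => lim (segment_quotient f x @ within `[a, b] x^').

Definition derive_segmentn (j : nat) f : R -> R := iter j derive_segment f.

Definition Cn_segment (n : enat) : set (R -> R) := [set f |
  (forall j : nat, le_enat (Fin j.+1) n ->
     forall x, x \in `[a, b] -> derivable_segment (derive_segmentn j f) x) /\
  (forall j : nat, le_enat (Fin j) n ->
     {within `[a, b], continuous (derive_segmentn j f)})].

Definition flat_ends (l r n : enat) : set (R -> R) := [set h |
  [/\ Cn_segment n h,
      forall j : nat, (1 <= j)%N -> le_enat (Fin j) l ->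
        derive_segmentn j h a = 0 &
      forall k : nat, (1 <= k)%N -> le_enat (Fin k) r ->
        derive_segmentn k h b = 0]].

End Segment.

(* Main.v *)
Require Import Defs.
From mathcomp Require Import all_boot all_order all_algebra.
From mathcomp Require Import all_classical all_reals all_analysis.
Import Order.TTheory GRing.Theory Num.Theory.
Import numFieldNormedType.Exports.
Local Open Scope classical_set_scope.
Local Open Scope ring_scope.

(** The theorem is the Leibniz formula.  If f and g are n times differentiable
    on [a, b], then for j <= n, at every point of [a, b],
      (f g)^(j) = \sum_(i <= j) 'C(j, i) f^(i) g^(j - i)     ([leibniz]).
    The right-hand side is continuous, and it is differentiable again when
    j < n, so that f g is of class C^n.  At an end where f and g are both flat
    of order l >= j >= 1, every summand vanishes: the summand i = 0 because it
    contains g^(j), and each other one because it contains f^(i) with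
    1 <= i <= j.

    The values of f g outside [a, b] carry no information, so the formula is an
    equality on [a, b] only, and the induction on j rests on the fact that the
    derivative at a point of [a, b] depends only on the restriction to [a, b]
    ([is_derive_segment_eq_in]). *)

Section SegmentDerivative.
Context {R : realType}.
Variables a b : R.
Implicit Types (f g : R -> R) (x d : R).

(** A limit statement is easier to compute with than the value of [lim], which
    is only meaningful together with a proof of convergence. *)
Definition is_derive_segment f x d : Prop :=
  segment_quotient f x @ within `[a, b] x^' --> d.

Lemma derivable_segmentP f x :
  derivable_segment a b f x -> is_derive_segment f x (derive_segment a b f x).
Proof. by []. Qed.

Lemma is_derive_segment_derivable f x d :
  is_derive_segment f x d -> derivable_segment a b f x.
Proof. exact: cvgP. Qed.

Lemma is_derive_segment_eq_in f g x d :
  {in `[a, b], f =1 g} -> x \in `[a, b] ->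
  is_derive_segment f x d -> is_derive_segment g x d.
Proof.
move=> fg xab; apply: cvg_trans; apply: fmap_within_eq => y yab.
by rewrite /segment_quotient !fg //; move: yab; rewrite inE.
Qed.

(** The segment is nondegenerate, so that a point of it can be approached within
    it from the right or from the left.  This makes limits unique. *)
Lemma within_segment_proper x :
  a < b -> x \in `[a, b] -> ProperFilter (within `[a, b] x^').
Proof.
move=> ab; rewrite in_itv /= => /andP[ax xb].
apply: Build_ProperFilter_ex => P xP.
have [xltb|bx] := ltP x b.
- have rightP : x^'+ (fun y => `[a, b]%classic y -> P y).
    have sub : (x^'+ : set_system R) `=>` x^'.
      by apply: within_subset => y ?; rewrite /= gt_eqF.
    exact: sub _ xP.
  suff /filter_ex : x^'+ P by [].
  apply: filterS3 rightP (nbhs_right_ge x) (nbhs_right_le xltb) => y yP xy yb.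
  by apply: yP; rewrite /= in_itv /= yb (le_trans ax).
- have altx : a < x by apply: lt_le_trans bx.
  have leftP : x^'- (fun y => `[a, b]%classic y -> P y).
    have sub : (x^'- : set_system R) `=>` x^'.
      by apply: within_subset => y ?; rewrite /= lt_eqF.
    exact: sub _ xP.
  suff /filter_ex : x^'- P by [].
  apply: filterS3 leftP (nbhs_left_le x) (nbhs_left_ge altx) => y yP yx ay.
  by apply: yP; rewrite /= in_itv /= ay (le_trans yx).
Qed.

Lemma is_derive_segmentE f x d : a < b -> x \in `[a, b] ->
  is_derive_segment f x d -> derive_segment a b f x = d.
Proof.
move=> ab xab fxd; have ? := within_segment_proper _ ab xab.
exact: cvg_lim fxd.
Qed.

Lemma is_derive_segment_cvg f x d :
  is_derive_segment f x d -> f @ within `[a, b] x^' --> f x.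
Proof.
move=> fxd.
have yx : y @[y --> within `[a, b] x^'] --> x.
  by move=> P /nbhs_dnbhs; exact: cvg_within.
(* For y != x the left-hand side is f y. *)
have : segment_quotient f x y * (y - x) + f x @[y --> within `[a, b] x^']
    --> d * (x - x) + f x.
  apply: cvgD; last exact: cvg_cst.
  by apply: cvgM => //; apply: cvgB => //; exact: cvg_cst.
rewrite subrr mulr0 add0r; apply: cvg_trans; apply: near_eq_cvg.
have : \forall y \near within `[a, b] x^', y != x.
  exact: cvg_within (nbhs_dnbhs_neq x).
apply: filterS => y ynx; rewrite /= /segment_quotient divfK ?subrK//.
by rewrite subr_eq0.
Qed.

Lemma is_derive_segment_cst c x : is_derive_segment (fun=> c) x 0.
Proof.
rewrite /is_derive_segment /segment_quotient.
under eq_cvg do rewrite subrr mul0r.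
exact: cvg_cst.
Qed.

Lemma is_derive_segmentM f g x df dg :
  is_derive_segment f x df -> is_derive_segment g x dg ->
  is_derive_segment (f \* g) x (df * g x + f x * dg).
Proof.
move=> fx gx.
have : segment_quotient f x y * g y + f x * segment_quotient g x y
    @[y --> within `[a, b] x^'] --> df * g x + f x * dg.
  apply: cvgD; apply: cvgM => //; last exact: cvg_cst.
  exact: is_derive_segment_cvg gx.
apply: cvg_trans; apply: near_eq_cvg; near=> y => /=.
by rewrite /segment_quotient mulrAC mulrA -mulrDl mulrBr mulrBl subrKA.
Unshelve. all: by end_near. Qed.

Lemma is_derive_segment_sum (m : nat) (F : nat -> R -> R) (dF : nat -> R) x :
  (forall i, (i < m)%N -> is_derive_segment (F i) x (dF i)) ->
  is_derive_segment (fun y => \sum_(i < m) F i y) x (\sum_(i < m) dF i).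
Proof.
move=> Fx; rewrite /is_derive_segment.
have -> : segment_quotient (fun y => \sum_(i < m) F i y) x =
          (fun y => \sum_(i < m) segment_quotient (F i) x y).
  by apply/funext => y; rewrite /segment_quotient -sumrB mulr_suml.
by apply: cvg_big => [|i _]; [exact: add_continuous|exact: Fx].
Qed.

End SegmentDerivative.

(** Pascal's rule, in the shape that the differentiation of the Leibniz sum
    calls for: u i and v i stand for the i-th derivatives of two functions. *)
Lemma leibniz_pascal (R : comPzRingType) (u v : nat -> R) (j : nat) :
  \sum_(i < j.+1) 'C(j, i)%:R * (u i.+1 * v (j - i)%N + u i * v (j - i).+1) =
  \sum_(i < j.+2) 'C(j.+1, i)%:R * (u i * v (j.+1 - i)%N).
Proof.
under eq_bigr do rewrite mulrDr.
rewrite big_split [RHS]big_ord_recl bin0 subn0 /=.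
under [in RHS]eq_bigr do rewrite /bump leq0n /= add1n binS natrD mulrDl subSS.
rewrite [in RHS]big_split /= addrA [RHS]addrC; congr (_ + _).
rewrite big_ord_recl bin0 subn0 [in RHS]big_ord_recr /= bin_small// mul0r addr0.
by congr (_ + _); apply: eq_bigr => i _; rewrite /bump leq0n add1n subnSK.
Qed.

Section Leibniz.
Context {R : realType}.
Variables (a b : R) (f g : R -> R).
Hypothesis ab : a < b.

Local Notation D := (derive_segmentn a b).

Definition leibniz_sum (j : nat) : R -> R :=
  fun x => \sum_(i < j.+1) 'C(j, i)%:R * (D i f x * D (j - i) g x).

Lemma is_derive_leibniz_sum (j : nat) (x : R) :
  (forall i, (i <= j)%N -> derivable_segment a b (D i f) x) ->
  (forall i, (i <= j)%N -> derivable_segment a b (D i g) x) ->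
  is_derive_segment a b (leibniz_sum j) x (leibniz_sum j.+1 x).
Proof.
move=> df dg; rewrite /leibniz_sum.
rewrite -(leibniz_pascal _ (fun i => D i f x) (fun i => D i g x)).
apply: (is_derive_segment_sum _ _ _
  (fun i y => 'C(j, i)%:R * (D i f y * D (j - i) g y))
  (fun i => 'C(j, i)%:R *
     (D i.+1 f x * D (j - i) g x + D i f x * D (j - i).+1 g x))) => i ij.
have fi := derivable_segmentP _ _ _ _ (df i ij).
have gi := derivable_segmentP _ _ _ _ (dg (j - i)%N (leq_subr _ _)).
have := is_derive_segmentM _ _ _ _ _ _ _
  (is_derive_segment_cst a b 'C(j, i)%:R x)
  (is_derive_segmentM _ _ _ _ _ _ _ fi gi).
by rewrite mul0r add0r.
Qed.

Lemma leibniz (j : nat) :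
  (forall i, (i < j)%N -> forall x, x \in `[a, b] ->
     derivable_segment a b (D i f) x) ->
  (forall i, (i < j)%N -> forall x, x \in `[a, b] ->
     derivable_segment a b (D i g) x) ->
  {in `[a, b], D j (f \* g) =1 leibniz_sum j}.
Proof.
elim: j => [|j IH] df dg x xab.
  by rewrite /leibniz_sum big_ord1 bin0 mul1r.
have fgj : {in `[a, b], leibniz_sum j =1 D j (f \* g)}.
  move=> y yab; apply/esym; apply: IH => // i ij.
  - exact: df (ltnW ij).
  - exact: dg (ltnW ij).
apply: is_derive_segmentE => //.
apply: (is_derive_segment_eq_in _ _ _ _ _ _ fgj) => //.
by apply: is_derive_leibniz_sum => i ij; [exact: df|exact: dg].
Qed.

Lemma leibniz_sum_continuous (j : nat) :
  (forall i, (i <= j)%N -> {within `[a, b], continuous (D i f)}) ->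
  (forall i, (i <= j)%N -> {within `[a, b], continuous (D i g)}) ->
  {within `[a, b], continuous (leibniz_sum j)}.
Proof.
move=> cf cg x; apply: cvg_big => [|i _]; first exact: add_continuous.
apply: cvgM; first exact: cvg_cst.
by apply: cvgM; [exact: cf (leq_ord i) x|exact: cg (leq_subr _ _) x].
Qed.

(** The value f x need not vanish: the summand i = 0 contains it, and is zero
    because of its other factor, D j g x. *)
Lemma leibniz_sum_flat (j : nat) (x : R) :
  (forall i, (0 < i <= j)%N -> D i f x = 0) -> D j g x = 0 ->
  leibniz_sum j x = 0.
Proof.
move=> f0 g0; apply: big1 => -[[|i] ij] _.
  by rewrite subn0 g0 !mulr0.
by rewrite f0 ?mul0r ?mulr0.
Qed.

End Leibniz.

Lemma le_enat_trans (m n p : enat) : le_enat m n -> le_enat n p -> le_enat m p.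
Proof. by case: m n p => [m|] [n|] [p|] //=; exact: leq_trans. Qed.

Lemma le_enat_Fin (i j : nat) (n : enat) :
  (i <= j)%N -> le_enat (Fin j) n -> le_enat (Fin i) n.
Proof. exact: (@le_enat_trans (Fin i) (Fin j) n). Qed.

Lemma Cn_segment_leibniz {R : realType} (a b : R) (n : enat) (f g : R -> R) :
  a < b -> Cn_segment a b n f -> Cn_segment a b n g ->
  forall j, le_enat (Fin j) n ->
    {in `[a, b], derive_segmentn a b j (f \* g) =1 leibniz_sum a b f g j}.
Proof.
move=> ab [df _] [dg _] j jn.
by apply: leibniz => // i ij; [apply: df|apply: dg]; exact: le_enat_Fin ij jn.
Qed.

(** On [a, b] the derivatives of f g agree with the Leibniz sums, and both
    requirements of class C^n see only the values on [a, b], so they can be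
    checked on the sums. *)
Lemma Cn_segmentM {R : realType} (a b : R) (n : enat) (f g : R -> R) :
  a < b -> Cn_segment a b n f -> Cn_segment a b n g ->
  Cn_segment a b n (f \* g).
Proof.
move=> ab Cf Cg; have fgE := Cn_segment_leibniz _ _ _ _ _ ab Cf Cg.
case: Cf Cg => [df cf] [dg cg]; split => j jn.
- move=> x xab; apply: is_derive_segment_derivable.
  have jn' := le_enat_Fin _ _ _ (leqnSn j) jn.
  apply: (is_derive_segment_eq_in _ _ (leibniz_sum a b f g j)) => //.
    by move=> y yab; rewrite fgE.
  by apply: is_derive_leibniz_sum => i ij; [apply: df|apply: dg] => //;
    exact: le_enat_Fin jn.
- apply: (@subspace_eq_continuous _ _ _ (leibniz_sum a b f g j)).
    by move=> y; rewrite inE => yab; exact/esym/fgE.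
  by apply: leibniz_sum_continuous => i ij; [apply: cf|apply: cg];
    exact: le_enat_Fin jn.
Qed.

(** Stated at a point e of [a, b], because the two ends are treated alike, each
    with its own order of flatness. *)
Lemma flat_endM {R : realType} (a b : R) (l n : enat) (f g : R -> R) (e : R) :
  a < b -> e \in `[a, b] -> le_enat l n ->
  Cn_segment a b n f -> Cn_segment a b n g ->
  (forall j, (1 <= j)%N -> le_enat (Fin j) l -> derive_segmentn a b j f e = 0) ->
  (forall j, (1 <= j)%N -> le_enat (Fin j) l -> derive_segmentn a b j g e = 0) ->
  forall j, (1 <= j)%N -> le_enat (Fin j) l ->
    derive_segmentn a b j (f \* g) e = 0.
Proof.
move=> ab eab ln Cf Cg f0 g0 j j0 jl.
rewrite (Cn_segment_leibniz _ _ _ _ _ ab Cf Cg) ?(le_enat_trans _ _ _ jl)//.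
apply: leibniz_sum_flat => // [i /andP[i0 ij]|]; last exact: g0.
by apply: f0 => //; exact: le_enat_Fin ij jl.
Qed.

Theorem theorem3 (R : realType) (a b : R) (l n r : enat)
    (ab : a < b)
    (l1 : le_enat (Fin 1) l) (ln : le_enat l n)
    (r1 : le_enat (Fin 1) r) (rn : le_enat r n) :
  forall f g : R -> R,
    flat_ends a b l r n f -> flat_ends a b l r n g ->
    flat_ends a b l r n (f \* g).
Proof.
move=> f g [Cf fa fb] [Cg ga gb]; split; first exact: Cn_segmentM.
- by apply: (flat_endM _ _ _ _ _ _ _ ab _ ln) => //; rewrite bound_itvE ltW.
- by apply: (flat_endM _ _ _ _ _ _ _ ab _ rn) => //; rewrite bound_itvE ltW.
Qed.
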